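(* Let $\{X_n\}_{n\ge 0}$ be a $\phi$-irreducible ergodic Markov chain on a state space $\mathcal{X}$ with stationary distribution $\pi$ (and arbitrary initial distribution), let $h:\mathcal{X}\to\mathbb{R}$ be measurable with $\pi(h)=\int_{\mathcal X} h\,d\pi$ finite, and let $e_n=\frac1n\sum_{i=1}^n h(X_i)$. Suppose that for some fixed $n\in\mathbb{N}=\{1,2,\dots\}$ the chain satisfies the variance bound $n\,\mathrm{Var}(e_n)\le B^2$ for some $B>0$, and the bias bound $|E(e_n)-\pi(h)|\le C$ for some $C\ge 0$. Let $\alpha\in(0,1)$ and set $$\delta=\frac{C}{\frac{B}{\sqrt{n\alpha}}+C}\in[0,1),\qquad a_n=\frac{B}{\sqrt{n\alpha}\,(1-\delta)}.$$ Then, for this $n$, the interval $I_n:=(e_n-a_n,\ e_n+a_n)$ satisfies $$P[\pi(h)\in I_n]\ \ge\ 1-\alpha.$$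
   Context: $\mathcal{X}$ is a general measurable state space and the chain is time-homogeneous with $n$-step transition kernels $P^n(x,\cdot)$. The chain is $\phi$-irreducible if there is a nonzero $\sigma$-finite measure $\phi$ on $\mathcal{X}$ such that for every measurable $A$ with $\phi(A)>0$ and every $x\in\mathcal{X}$ there is $n\in\mathbb{N}$ with $P^n(x,A)>0$. Ergodic means that $\pi$ is a stationary probability distribution and $\lim_{n\to\infty}\|P^n(x,\cdot)-\pi(\cdot)\|=0$ for $\pi$-a.e. $x\in\mathcal{X}$, where $\|\mu-\nu\|=\sup_A|\mu(A)-\nu(A)|$ is total variation distance. $P$, $E$ and $\mathrm{Var}$ all refer to the law of the chain under its given initial distribution; the variance bound includes that $e_n$ has finite second moment. *)

(* Defs.v *)
From HB Require Import structures.
From mathcomp Require Import all_boot all_order all_algebra.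
From mathcomp Require Import all_classical all_reals all_analysis.

Set Implicit Arguments.
Unset Strict Implicit.
Unset Printing Implicit Defensive.

Import Order.TTheory GRing.Theory Num.Theory.
Import numFieldNormedType.Exports.

Local Open Scope classical_set_scope.
Local Open Scope ring_scope.
Local Open Scope ereal_scope.

Section transition_kernels.
Context {d : measure_display} {T : measurableType d} {R : realType}.
Variable K : R.-pker T ~> T.

(* The type only records sub-stochasticity, because this is what the library
   provides for composites; every [nstep n x] is in fact a probability. *)
Fixpoint nstep (n : nat) : R.-spker T ~> T :=
  if n is m.+1 then mkcomp_noparam (nstep m) K
  else kdirac (@measurable_id _ T setT).

(* [0 < n]: the natural numbers start at 1 here. *)
Definition phi_irreducible : Prop :=
  exists phi : {sigma_finite_measure set T -> \bar R},
    phi setT != 0 /\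
    forall A : set T, measurable A -> 0 < phi A ->
    forall x : T, exists2 n : nat, (0 < n)%N & 0 < nstep n x A.

Definition stationary (pi : probability T R) : Prop :=
  forall A : set T, measurable A -> \int[pi]_x K x A = pi A.

(* Normalised as a supremum over events, hence with values in [0, 1] on
   probabilities. *)
Definition tv_distance (mu nu : {measure set T -> \bar R}) : \bar R :=
  ereal_sup [set `|mu A - nu A| | A in measurable].

Definition ergodic (pi : probability T R) : Prop :=
  stationary pi /\
  {ae pi, forall x, tv_distance (nstep n x) pi @[n --> \oo] --> 0}.

End transition_kernels.

Section chains.
Context {d d' : measure_display} {Omega : measurableType d}
  {T : measurableType d'} {R : realType}.
Variable P : probability Omega R.
Variable X : nat -> {RV P >-> T}.

(* For every [E] in the sigma-algebra generated by [X 0, ..., X n],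
   P(E and X_{n+1} in A) = E[1_E K(X_n, A)]; that is, [K (X n) A] is a version
   of the conditional probability of [X n.+1 \in A] given the past.  The law of
   [X 0] is unconstrained. *)
Definition markov_chain (K : R.-pker T ~> T) : Prop :=
  forall (n : nat) (E : set Omega) (A : set T),
    g_sigma_preimage (fun i : 'I_n.+1 => X i : Omega -> T) E -> measurable A ->
    P (E `&` X n.+1 @^-1` A) = \int[P]_(w in E) K (X n w) A.

Definition ergodic_mean (h : T -> R) (n : nat) : Omega -> R :=
  fun w => (n%:R^-1 * \sum_(1 <= i < n.+1) h (X i w))%R.

End chains.

(* Main.v *)
Require Import Defs.
From HB Require Import structures.
From mathcomp Require Import all_boot all_order all_algebra.
From mathcomp Require Import all_classical all_reals all_analysis.
From mathcomp Require Import measurable_realfun.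

Import Order.TTheory GRing.Theory Num.Theory.
Import numFieldNormedType.Exports.

Local Open Scope classical_set_scope.
Local Open Scope ring_scope.

(** Only the second moment of the ergodic mean [e] matters: the result is
    Chebyshev's inequality for an estimator with a bias.  Write
    [s = B / sqrt (n * alpha)].  Then [delta = C / (s + C)], so
    [1 - delta = s / (s + C)] and the half-width is [a = s / (1 - delta) = s + C].
    When [e] misses [pi(h)] by at least [s + C], the bias bound lets [pi(h)] be
    traded for the mean of [e] at the price of [C], so [e] is at distance at
    least [s] from its own mean.  By Chebyshev this has probability at most
    [Var(e) / s ^ 2], and [s] is chosen so that [Var(e) <= B ^ 2 / n] makes
    this quotient at most [alpha].

    The probabilistic step is [biased_chebyshev]; [radius_eq] identifies the
    half-width. *)

(** The complement of the event lies in the Chebyshev event for the mean of [Y]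
    with deviation [s], since moving the centre from [c] to that mean costs at
    most [C]. *)
Lemma biased_chebyshev (R : realType) (d : measure_display)
    (Omega : measurableType d) (P : probability Omega R) (Y : Omega -> R)
    (c s C alpha : R) :
  Y \in Lfun P 2%:E -> 0 < s ->
  ('V_P[Y] <= (alpha * s ^+ 2)%:E)%E ->
  (`|'E_P[Y] - c%:E| <= C%:E)%E ->
  ((1 - alpha)%:E <= P [set w | (`|Y w - c| < s + C)%R])%E.
Proof.
move=> Y2 s0 hvar hbias.
have Y1 : Y \in Lfun P 1 by apply: Lfun_subset12 Y2; exact: fin_num_measure.
have hfin : ('E_P[Y])%E \is a fin_num by exact: expectation_fin_num.
have mY : measurable_fun setT Y.
  by move/sub_Lfun_mfun : Y2; rewrite inE.
pose Z : {RV P >-> R} := HB.pack Y (isMeasurableFun.Build _ _ _ _ Y mY).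
have mfar m t : measurable [set w | (t <= `|Y w - m|)%R].
  rewrite -[X in measurable X]setTI; apply: measurable_fun_le => //.
  by apply: measurableT_comp => //; exact: measurable_funB.
have -> : [set w | (`|Y w - c| < s + C)%R] =
          ~` [set w | (s + C <= `|Y w - c|)%R].
  by apply/seteqP; split => w /=; rewrite ltNge => /negP.
(* Off the event, [s + C <= `|Y - c| <= `|Y - 'E_P[Y]| + C]. *)
have hfar : (P [set w | (s + C <= `|Y w - c|)%R] <= alpha%:E)%E.
  apply: (@le_trans _ _ (P [set w | (s <= `|Y w - fine ('E_P[Y])%E|)%R])).
    apply: le_measure; rewrite ?inE// => w /= hw.
    move: hbias; rewrite -(fineK hfin) -EFinB abse_EFin lee_fin => hb.
    rewrite -(lerD2r C); apply: (le_trans hw).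
    apply: (le_trans (ler_distD (fine ('E_P[Y])%E) _ _)).
    by rewrite lerD2l.
  apply: (le_trans (chebyshev Z s0)).
  by rewrite lee_pdivrMl ?exprn_gt0// -EFinM mulrC.
by rewrite probability_setC// EFinB leeB.
Qed.

Lemma radius_eq (R : realFieldType) (s C : R) : 0 < s -> 0 <= C ->
  s / (1 - C / (s + C)) = s + C.
Proof.
move=> s0 C0; have sC0 : s + C != 0 by rewrite gt_eqF// ltr_wpDr.
rewrite -[X in X - _](divff sC0) -mulrBl addrK.
by rewrite invf_div mulrCA divff ?mulr1// gt_eqF.
Qed.

Theorem theorem2 (R : realType) (d d' : measure_display)
    (Omega : measurableType d) (T : measurableType d')
    (P : probability Omega R) (K : R.-pker T ~> T) (pi : probability T R)
    (X : nat -> {RV P >-> T}) (h : T -> R) (n : nat) (B C alpha : R)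
    (hchain : markov_chain X K)
    (hirr : phi_irreducible K)
    (herg : ergodic K pi)
    (hmeas : measurable_fun setT h)
    (hint : pi.-integrable setT (EFin \o h))
    (hn : (0 < n)%N)
    (hB : 0 < B)
    (hC : 0 <= C)
    (halpha : 0 < alpha < 1) :
  let e := ergodic_mean X h n in
  let pih := \int[pi]_x h x in
  let delta := C / (B / Num.sqrt (n%:R * alpha) + C) in
  let a := B / (Num.sqrt (n%:R * alpha) * (1 - delta)) in
  e \in Lfun P 2%:E ->
  (n%:R%:E * 'V_P[e] <= (B ^+ 2)%:E)%E ->
  (`|'E_P[e] - pih%:E| <= C%:E)%E ->
  0 <= delta < 1 /\
  ((1 - alpha)%:E <= P [set w | (pih \in `]e w - a, e w + a[)%R])%E.
Proof.
move=> e pih delta a e2 hvar hbias.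
have [a0 _] := andP halpha.
have n0 : 0 < n%:R :> R by rewrite ltr0n.
have na0 : 0 < n%:R * alpha by rewrite mulr_gt0.
pose r := Num.sqrt (n%:R * alpha).
have r0 : 0 < r by rewrite sqrtr_gt0.
have s0 : 0 < B / r by rewrite divr_gt0.
have sC0 : 0 < B / r + C by rewrite ltr_wpDr.
split.
  rewrite /delta -/r divr_ge0 ?(ltW sC0)//=.
  by rewrite ltr_pdivrMr// mul1r ltrDr.
(* For the largest variance allowed, [B ^ 2 / n], Chebyshev's bound at
   deviation [B / r] is exactly [alpha]. *)
have hs2 : alpha * (B / r) ^+ 2 = n%:R^-1 * B ^+ 2.
  rewrite expr_div_n sqr_sqrtr ?(ltW na0)// invfM mulrCA (mulrCA alpha).
  by rewrite divff ?mulr1 1?mulrC// gt_eqF.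
have -> : [set w | (pih \in `]e w - a, e w + a[)%R] =
          [set w | (`|e w - pih| < B / r + C)%R].
  rewrite /a /delta invfM mulrA radius_eq// -/r; apply/seteqP; split => w /=;
    by rewrite in_itv/= distrC -ltr_distl.
apply: biased_chebyshev => //.
by rewrite hs2 EFinM lee_pdivlMl.
Qed.
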